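(* Let $n\geq 1$, let $W=\mathfrak{S}_n$ with $S=\{s_1,\dots,s_{n-1}\}$, $s_i=(i,i+1)$, and let $\ast=\mathrm{id}$. Let $M$ be the $\mathcal{H}_u$-module described in the context and $X_{\emptyset}=\sum_{x\in\mathfrak{S}_n}u^{-\ell(x)}T_x$. Then there is a unique isomorphism of left $\mathcal{H}^{\mathbb{Q}(u)}$-modules $\eta:\mathbb{Q}(u)\otimes_{\mathcal{A}}M\xrightarrow{\ \sim\ }\mathcal{H}^{\mathbb{Q}(u)}X_{\emptyset}$ such that $\eta(a_1)=X_{\emptyset}$.
   Context: $u$ is an indeterminate, $\mathcal{A}=\mathbb{Z}[u,u^{-1}]$. $\mathcal{H}_u$ is the Iwahori–Hecke algebra of $\mathfrak{S}_n$ over $\mathcal{A}$ with parameter $u^2$: free $\mathcal{A}$-module with basis $\{T_w\}_{w\in\mathfrak{S}_n}$, unit $T_1$, $T_wT_{w'}=T_{ww'}$ if $\ell(ww')=\ell(w)+\ell(w')$, and $(T_s+1)(T_s-u^2)=0$ for $s\in S$; $\ell$ is the Coxeter length. $\mathcal{H}^{\mathbb{Q}(u)}=\mathbb{Q}(u)\otimes_{\mathcal{A}}\mathcal{H}_u$. Let $I_\ast=\{w\in\mathfrak{S}_n: w^2=1\}$. $M$ is the free $\mathcal{A}$-module with basis $\{a_w: w\in I_\ast\}$, endowed with the (unique, by Lusztig–Vogan) $\mathcal{H}_u$-module structure such that for $s\in S$, $w\in I_\ast$: $T_sa_w=ua_w+(u+1)a_{sw}$ if $sw=ws$ and $\ell(sw)>\ell(w)$;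 $T_sa_w=(u^2-u-1)a_w+(u^2-u)a_{sw}$ if $sw=ws$ and $\ell(sw)<\ell(w)$; $T_sa_w=a_{sws}$ if $sw\neq ws$ and $\ell(sw)>\ell(w)$; $T_sa_w=(u^2-1)a_w+u^2a_{sws}$ if $sw\neq ws$ and $\ell(sw)<\ell(w)$. *)

(* Defs.v *)
From HB Require Import structures.
From mathcomp Require Import all_boot all_order all_fingroup all_algebra.
From mathcomp Require Import fraction.
Set Implicit Arguments. Unset Strict Implicit. Unset Printing Implicit Defensive.
Import Order.TTheory GRing.Theory Num.Theory.
Local Open Scope ring_scope.

Notation Qu := {fraction {poly rat}}.
Definition u : Qu := tofrac ('X : {poly rat}).

(* The simple reflection s_{i+1} = (i, i+1) (0-based points of 'I_n),
   indexed by i : 'I_(n.-1). *)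
Lemma sref_lt1 n (i : 'I_n.-1) : ((i : nat) < n)%N.
Proof. case: i => i /= Hi; case: n Hi => [|n] //= Hi; exact: ltnW. Qed.
Lemma sref_lt2 n (i : 'I_n.-1) : (i.+1 < n)%N.
Proof. by case: i => i /= Hi; case: n Hi. Qed.
Definition sref n (i : 'I_n.-1) : 'S_n :=
  tperm (Ordinal (sref_lt1 i)) (Ordinal (sref_lt2 i)).

(* Coxeter length: the least k such that w is a product of k simple
   reflections (searched in 0..n*n, which always suffices). *)
Definition coxlen n (w : 'S_n) : nat :=
  find (fun k : nat => [exists t : k.-tuple 'I_n.-1,
                          (\prod_(i <- t) sref i)%g == w])
       (iota 0 (n * n)%N.+1).

(* For a left H-module V whose structure is given by the operators
   op i = (action of T_{s_i}), T_x acts as T_s T_{sx} where s is the first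
   simple reflection with l(sx) < l(x) (recursion on l(x)). *)
Fixpoint Tfuel n (V : lmodType Qu) (op : 'I_n.-1 -> V -> V)
    (k : nat) (x : 'S_n) (v : V) : V :=
  match k with
  | 0 => v
  | k'.+1 =>
      match [pick i : 'I_n.-1 | (coxlen (sref i * x)%g < coxlen x)%N] with
      | Some i => op i (Tfuel op k' (sref i * x)%g v)
      | None => v
      end
  end.
Definition Tact n (V : lmodType Qu) (op : 'I_n.-1 -> V -> V) (x : 'S_n)
    (v : V) : V := Tfuel op (coxlen x) x v.

(* The Hecke algebra H^{Q(u)}: Q(u)-vector space with basis (T_w)_w; an
   element h is the function w |-> coefficient of T_w. *)
Notation Hecke n := {ffun 'S_n -> Qu^o}.

Definition Haction n (V : lmodType Qu) (op : 'I_n.-1 -> V -> V)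
    (h : Hecke n) (v : V) : V := \sum_(x : 'S_n) h x *: Tact op x v.

(* left multiplication by T_s on H: T_s T_w = T_{sw} if l(sw) > l(w),
   and (u^2-1) T_w + u^2 T_{sw} otherwise *)
Definition coefH n (i : 'I_n.-1) (w v : 'S_n) : Qu :=
  let s := sref i in
  if (coxlen w < coxlen (s * w)%g)%N then (v == (s * w)%g)%:R
  else (v == w)%:R * (u ^+ 2 - 1) + (v == (s * w)%g)%:R * u ^+ 2.
Definition opH n (i : 'I_n.-1) (h : Hecke n) : Hecke n :=
  [ffun v => \sum_(w : 'S_n) h w * coefH i w v].

Definition hmul n (h h' : Hecke n) : Hecke n := Haction (@opH n) h h'.
Definition Tb n (w : 'S_n) : Hecke n := [ffun x => (x == w)%:R].
Definition Xempty n : Hecke n := [ffun x => u ^- coxlen x].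

Definition Invol n := {w : 'S_n | (w * w == 1)%g}.
Notation Mod n := {ffun Invol n -> Qu^o}.
(* coefficient of a_v in T_s a_w *)
Definition coefM n (i : 'I_n.-1) (w v : Invol n) : Qu :=
  let s := sref i in
  let w' := val w in let v' := val v in
  if (s * w' == w' * s)%g then
    if (coxlen w' < coxlen (s * w')%g)%N
    then (v == w)%:R * u + (v' == (s * w')%g)%:R * (u + 1)
    else (v == w)%:R * (u ^+ 2 - u - 1) + (v' == (s * w')%g)%:R * (u ^+ 2 - u)
  else
    if (coxlen w' < coxlen (s * w')%g)%N
    then (v' == (s * w' * s)%g)%:R
    else (v == w)%:R * (u ^+ 2 - 1) + (v' == (s * w' * s)%g)%:R * u ^+ 2.
Definition opM n (i : 'I_n.-1) (m : Mod n) : Mod n :=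
  [ffun v => \sum_(w : Invol n) m w * coefM i w v].
Definition a1 n : Mod n := [ffun w : Invol n => (val w == 1%g)%:R].

Definition is_iso_onto_HX n (eta : Mod n -> Hecke n) : Prop :=
  [/\ (forall (a : Qu) (m m' : Mod n), eta (a *: m + m') = a *: eta m + eta m'),
      (forall (h : Hecke n) (m : Mod n),
          eta (Haction (@opM n) h m) = hmul h (eta m)),
      injective eta &
      (forall y : Hecke n,
          (exists h : Hecke n, y = hmul h (Xempty n)) <-> (exists m, eta m = y))].

(* Main.v *)
Require Import Defs.
From HB Require Import structures.
From mathcomp Require Import all_boot all_order all_fingroup all_algebra.
From mathcomp Require Import fraction.
From mathcomp Require Import zify ring.
Set Implicit Arguments. Unset Strict Implicit. Unset Printing Implicit Defensive.
Import Order.TTheory GRing.Theory Num.Theory.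

(** [M] carries a diagonal nondegenerate form [( , )] for which every [T_s] is
    self-adjoint, and the isomorphism is
    [m |-> \sum_x u^(-2 l(x)) (T_x a_1, m) T_x].  It intertwines the actions once
    the operators on [M] satisfy the braid relations, is injective because the
    [T_x a_1] span [M], and sends [a_1] to [X_emptyset] because the coefficient
    of [a_1] in [T_x a_1] is [u^l(x)].  For [u = q] this coefficient counts the
    [F_q]-rational flags in relative position [x] to a rational flag, inside the
    flag variety over [F_(q^2)]: [a_w] corresponds to the flags in position [w]
    to their Frobenius conjugate. *)

(** * Permutations as functions on nat *)

(* [w] extended by the identity to [nat], so that descents become linear arithmetic. *)
Definition pn n (w : 'S_n) (x : nat) : nat :=
  if insub x is Some p then val (w p) else x.

Definition sn (i x : nat) : nat :=
  if x == i then i.+1 else if x == i.+1 then i else x.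

(** An equality test with a conditional on either side is skipped, so nested reflections are
    resolved from the inside out. *)
Ltac sn_case := rewrite ?/sn; repeat match goal with |- context [@eq_op ?T ?a ?b] =>
  lazymatch constr:((a, b)) with
  | context [if _ then _ else _] => fail
  | _ => case: (@eqP T a b) => ?
  end end.
Ltac sn_lia := sn_case; lia.

Lemma pnE n (w : 'S_n) (p : 'I_n) : pn w p = w p.
Proof. by rewrite /pn valK. Qed.

Lemma pn_out n (w : 'S_n) x : n <= x -> pn w x = x.
Proof. by move=> h; rewrite /pn insubF // ltnNge h. Qed.

Lemma pn_lt n (w : 'S_n) x : (pn w x < n) = (x < n).
Proof.
case: (ltnP x n) => h; last by rewrite pn_out // ltnNge h.
by rewrite (pnE w (Ordinal h)) ltn_ord.
Qed.

Lemma pnM n (v w : 'S_n) x : pn (v * w)%g x = pn w (pn v x).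
Proof.
case: (ltnP x n) => h; last by rewrite !pn_out // ?pn_out.
by rewrite (pnE _ (Ordinal h)) (pnE v (Ordinal h)) pnE permM.
Qed.

Lemma pn1 n x : pn (1%g : 'S_n) x = x.
Proof.
case: (ltnP x n) => h; last by rewrite pn_out.
by rewrite (pnE _ (Ordinal h)) perm1.
Qed.

Lemma pnK n (w : 'S_n) : cancel (pn w) (pn w^-1%g).
Proof. by move=> x; rewrite -pnM mulgV pn1. Qed.

Lemma pnKV n (w : 'S_n) : cancel (pn w^-1%g) (pn w).
Proof. by move=> x; rewrite -pnM mulVg pn1. Qed.

Lemma pn_inj n (w : 'S_n) : injective (pn w).
Proof. exact: can_inj (pnK w). Qed.

Lemma pn_ext n (v w : 'S_n) : pn v =1 pn w -> v = w.
Proof. by move=> h; apply/permP => p; apply: val_inj; rewrite /= -!pnE h. Qed.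

Lemma ltn_iS n (i : 'I_n.-1) : i.+1 < n.
Proof. exact: sref_lt2. Qed.

Lemma pn_sref n (i : 'I_n.-1) : pn (sref i) =1 sn i.
Proof.
move=> x; have h := ltn_iS i.
case: (ltnP x n) => hx; last by rewrite pn_out //; sn_lia.
by rewrite (pnE _ (Ordinal hx)) /sref permE /= -!val_eqE /= /sn; case: eqP => //; case: eqP.
Qed.

Lemma snK i : involutive (sn i).
Proof. move=> x; sn_lia. Qed.

Lemma srefK n (i : 'I_n.-1) : (sref i * sref i = 1)%g.
Proof. by apply: pn_ext => x; rewrite pnM !pn_sref snK pn1. Qed.

Lemma srefKl n (i : 'I_n.-1) (w : 'S_n) : (sref i * (sref i * w) = w)%g.
Proof. by rewrite mulgA srefK mul1g. Qed.

(** Products compose from left to right, so left multiplication by [sref i] permutes positions;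
    whether it lowers the length is read off from the values at [i] and [i.+1]. *)
Lemma pn_sM n (i : 'I_n.-1) (w : 'S_n) x : pn (sref i * w)%g x = pn w (sn i x).
Proof. by rewrite pnM pn_sref. Qed.

(** * Length and inversions *)

Definition ninv_set n (w : 'S_n) := [set p : 'I_n * 'I_n | (p.1 < p.2) && (w p.2 < w p.1)].
Definition ninv n (w : 'S_n) := #|ninv_set w|.

(** Applying [sref i] to both entries of a pair matches the inversions of [w] with those of
    [sref i * w] other than (i, i+1). *)
Lemma ninv_up n (i : 'I_n.-1) (w : 'S_n) : pn w i < pn w i.+1 ->
  ninv (sref i * w)%g = (ninv w).+1.
Proof.
move=> h; have hi := ltn_iS i.
pose a := Ordinal (ltnW hi); pose b := Ordinal hi.
pose f (p : 'I_n * 'I_n) := (sref i p.1, sref i p.2).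
have f_inj : injective f by move=> [p q] [p' q'] [/perm_inj -> /perm_inj ->].
rewrite /ninv (cardsD1 (a, b)) -(card_preimset _ f_inj) inE /= !permM.
have sa : pn w (sn i i) = pn w i.+1 by congr pn; sn_lia.
have sb : pn w (sn i i.+1) = pn w i by congr pn; sn_lia.
rewrite -!pnE !pn_sref sa sb h leqnn add1n.
congr (_.+1); apply: eq_card => -[p q]; rewrite !inE /= -!pnE !pn_sM !pn_sref xpair_eqE -!val_eqE /=.
rewrite -!(pnE (sref i)) !pn_sref !snK.
case: (ltnP (pn w q) (pn w p)) => h1; rewrite ?andbT ?andbF //.
have : (p != i :> nat) || (q != i.+1 :> nat).
  by rewrite -negb_and; apply/negP => /andP[/eqP e1 /eqP e2]; rewrite e1 e2 in h1; lia.
sn_lia.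
Qed.

Lemma ninv_down n (i : 'I_n.-1) (w : 'S_n) : pn w i.+1 < pn w i ->
  ninv w = (ninv (sref i * w)%g).+1.
Proof.
move=> h; rewrite -(ninv_up (i := i)) ?srefKl // !pn_sM.
by have -> : sn i i = i.+1; [sn_lia|have -> : sn i i.+1 = i by sn_lia].
Qed.

Lemma descentE n (i : 'I_n.-1) (w : 'S_n) : (pn w i.+1 < pn w i) = ~~ (pn w i < pn w i.+1).
Proof. by have := @pn_inj n w i i.+1; lia. Qed.

Lemma ninv_leS n (i : 'I_n.-1) (w : 'S_n) : ninv (sref i * w)%g <= (ninv w).+1.
Proof.
have [h|] := boolP (pn w i < pn w i.+1); first by rewrite ninv_up.
by rewrite -descentE => /ninv_down ->; lia.
Qed.

Lemma ninv1 n : ninv (1%g : 'S_n) = 0.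
Proof. by apply: eq_card0 => -[p q]; rewrite !inE !perm1 /=; lia. Qed.

(** Increasing values give [y <= w y] by induction upwards from 0 and [w y <= y] by induction
    downwards from [n.-1]. *)
Lemma no_descent n (w : 'S_n) :
  (forall i : 'I_n.-1, pn w i < pn w i.+1) -> w = 1%g.
Proof.
move=> h; apply: pn_ext => x; rewrite pn1.
have h' y : y.+1 < n -> pn w y < pn w y.+1.
  by move=> hy; have hy' : y < n.-1 by [lia]; exact: (h (Ordinal hy')).
have le_w y : y < n -> y <= pn w y.
  by elim: y => // y IH hy; have := h' _ hy; have := IH (ltnW hy); lia.
have ge_w k : k < n -> pn w (n.-1 - k) <= n.-1 - k.
  elim: k => [|k IH] hk; first by rewrite subn0; have := pn_lt w n.-1; lia.
  have := h' (n.-1 - k.+1); have -> : (n.-1 - k.+1).+1 = n.-1 - k by lia.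
  by have := IH (ltnW hk); lia.
case: (ltnP x n) => hx; last exact: pn_out.
have := ge_w (n.-1 - x); have -> : n.-1 - (n.-1 - x) = x by lia.
by have := le_w _ hx; lia.
Qed.

Lemma ex_descent n (w : 'S_n) : w != 1%g ->
  exists i : 'I_n.-1, pn w i.+1 < pn w i.
Proof.
move=> w1; have [/existsP //|] := boolP [exists i : 'I_n.-1, pn w i.+1 < pn w i].
rewrite negb_exists => /forallP h; case/eqP: w1; apply: no_descent => i.
by have := h i; rewrite descentE negbK.
Qed.

Lemma ninv_word_le n (s : seq 'I_n.-1) : ninv (\prod_(i <- s) sref i)%g <= size s.
Proof.
elim: s => [|i s IH]; first by rewrite big_nil ninv1.
by rewrite big_cons; apply: leq_trans (ninv_leS _ _) _.
Qed.

Lemma ex_reduced_word n (w : 'S_n) :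
  exists t : (ninv w).-tuple 'I_n.-1, (\prod_(i <- t) sref i)%g = w.
Proof.
have [k] := ubnP (ninv w); elim: k w => // k IH w hk.
have [->|/ex_descent[i hi]] := eqVneq w 1%g.
  by rewrite ninv1; exists [tuple]; rewrite big_nil.
have e := ninv_down hi; have [|t ht] := IH (sref i * w)%g; first by lia.
by rewrite e; exists [tuple of i :: t]; rewrite big_cons ht srefKl.
Qed.

(** No word is shorter than the number of inversions of its product, and stripping descents gives a
    word of exactly that length. As inversions are pairs of points, the search range up to [n * n]
    contains it. *)
Lemma coxlenE n (w : 'S_n) : coxlen w = ninv w.
Proof.
rewrite /coxlen; set p := fun k : nat => _.
have le_n : ninv w < (n * n).+1.
  by rewrite ltnS; apply: leq_trans (max_card _) _; rewrite card_prod card_ord.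
have p_inv : p (ninv w).
  by have [t ht] := ex_reduced_word w; apply/existsP; exists t; apply/eqP.
have hp : has p (iota 0 (n * n).+1).
  by apply/hasP; exists (ninv w); rewrite // mem_iota.
apply/eqP; rewrite eqn_leq; apply/andP; split.
  rewrite leqNgt; apply/negP => h.
  by have := before_find 0 h; rewrite nth_iota ?add0n ?p_inv.
have := nth_find 0 hp; rewrite nth_iota; last by move: hp; rewrite has_find size_iota.
rewrite add0n => /existsP[t /eqP e].
by have := ninv_word_le t; rewrite e size_tuple.
Qed.

Lemma ltn_coxlen n (i : 'I_n.-1) (w : 'S_n) :
  (coxlen w < coxlen (sref i * w)%g) = (pn w i < pn w i.+1).
Proof.
rewrite !coxlenE; have [h|] := boolP (pn w i < pn w i.+1); first by rewrite ninv_up ?ltnSn.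
by rewrite -descentE => /ninv_down ->; rewrite ltnNge leqnSn.
Qed.

Lemma gtn_coxlen n (i : 'I_n.-1) (w : 'S_n) :
  (coxlen (sref i * w)%g < coxlen w) = (pn w i.+1 < pn w i).
Proof.
rewrite !coxlenE; have [/ninv_down->|] := boolP (pn w i.+1 < pn w i); first by rewrite ltnSn.
by rewrite descentE negbK => /ninv_up ->; rewrite ltnNge leqnSn.
Qed.

Lemma ninvV n (w : 'S_n) : ninv w^-1%g = ninv w.
Proof.
pose f (p : 'I_n * 'I_n) := (w p.2, w p.1).
have f_inj : injective f by move=> [p q] [p' q'] [/perm_inj -> /perm_inj ->].
rewrite /ninv -(card_preimset _ f_inj); apply: eq_card => -[p q].
by rewrite !inE /= !permK andbC.
Qed.

(** * Independence of [T_x] from the reduced word *)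

Section TactTheory.
Variables (n : nat) (V : lmodType Qu) (op : 'I_n.-1 -> V -> V).

Lemma Tact1 v : Tact op 1%g v = v.
Proof. by rewrite /Tact coxlenE ninv1. Qed.

Lemma Tact_pick (x : 'S_n) v : x != 1%g ->
  exists2 i : 'I_n.-1, pn x i.+1 < pn x i & Tact op x v = op i (Tact op (sref i * x)%g v).
Proof.
move=> x1; have [i0 h0] := ex_descent x1; rewrite /Tact (coxlenE x) (ninv_down h0) /=.
case: pickP => [i|/(_ i0)]; last by rewrite gtn_coxlen h0.
rewrite gtn_coxlen => hi; exists i => //.
by rewrite coxlenE; congr (op _ (Tfuel _ _ _ _)); have := ninv_down h0; rewrite (ninv_down hi) => -[].
Qed.

Hypothesis op_comm : forall (i j : 'I_n.-1) v, i.+1 < j -> op i (op j v) = op j (op i v).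
Hypothesis op_braid : forall (i j : 'I_n.-1) v, i.+1 = j ->
  op i (op j (op i v)) = op j (op i (op j v)).

(** Matsumoto's argument, by induction on length: if [x] has two descents, both strippings continue
    to a common element, with two reflections removed for distant descents and the longest element
    of rank two removed for adjacent ones. The relations between the operators then identify the two
    results. *)
Lemma Tact_down (x : 'S_n) (i : 'I_n.-1) v : pn x i.+1 < pn x i ->
  Tact op x v = op i (Tact op (sref i * x)%g v).
Proof.
have [k] := ubnP (ninv x); elim: k x i => // k IH x i hk hi.
have x1 : x != 1%g by apply: contraTneq hi => ->; rewrite !pn1; lia.
have step (y : 'S_n) (a : 'I_n.-1) : ninv y < k -> pn y a.+1 < pn y a ->
    ninv (sref a * y)%g < k /\ Tact op y v = op a (Tact op (sref a * y)%g v).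
  by move=> hy ha; split; [have := ninv_down ha; lia|exact: IH].
have inv_x (a : 'I_n.-1) : pn x a.+1 < pn x a -> ninv (sref a * x)%g < k.
  by move=> ha; have := ninv_down ha; lia.
have far (a b : 'I_n.-1) : a.+1 < b -> pn x a.+1 < pn x a -> pn x b.+1 < pn x b ->
    op a (Tact op (sref a * x)%g v) = op b (Tact op (sref b * x)%g v).
  move=> ab ha hb.
  have [|_ ->] := step _ b (inv_x a ha).
    by rewrite !pn_sM; have [-> ->] : sn a b = b /\ sn a b.+1 = b.+1 by split; sn_lia.
  have [|_ ->] := step _ a (inv_x b hb).
    by rewrite !pn_sM; have [-> ->] : sn b a = a /\ sn b a.+1 = a.+1 by split; sn_lia.
  rewrite op_comm //; congr (op _ (op _ (Tact _ _ _))).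
  by apply: pn_ext => p; rewrite !pn_sM; congr pn; sn_lia.
have near (a b : 'I_n.-1) : a.+1 = b -> pn x a.+1 < pn x a -> pn x b.+1 < pn x b ->
    op a (Tact op (sref a * x)%g v) = op b (Tact op (sref b * x)%g v).
  move=> ab ha hb; rewrite -ab in hb.
  have [|lt_ba ->] := step _ b (inv_x a ha).
    rewrite !pn_sM -ab; have [-> ->] : sn a a.+1 = a /\ sn a a.+2 = a.+2 by split; sn_lia.
    exact: ltn_trans hb ha.
  have [|_ ->] := step _ a lt_ba.
    rewrite !pn_sM -ab.
    by have [-> ->] : sn a (sn a.+1 a) = a.+1 /\ sn a (sn a.+1 a.+1) = a.+2 by split; sn_lia.
  have hb' : pn x b.+1 < pn x b by rewrite -ab.
  have [|lt_ab ->] := step _ a (inv_x b hb').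
    rewrite !pn_sM -ab; have [-> ->] : sn a.+1 a = a /\ sn a.+1 a.+1 = a.+2 by split; sn_lia.
    exact: ltn_trans hb ha.
  have [|_ ->] := step _ b lt_ab.
    rewrite !pn_sM -ab.
    by have [-> ->] : sn a.+1 (sn a a.+1) = a /\ sn a.+1 (sn a a.+2) = a.+1 by split; sn_lia.
  rewrite op_braid //; congr (op _ (op _ (op _ (Tact _ _ _)))).
  by apply: pn_ext => p; rewrite !pn_sM; congr pn; sn_lia.
have [j hj ->] := Tact_pick v x1.
case: (ltngtP i j) => [ij|ji|/val_inj -> //].
  by apply: esym; case: (ltngtP i.+1 j) => h; [exact: far|exfalso; lia|exact: near].
by case: (ltngtP j.+1 i) => h; [exact: far|exfalso; lia|exact: near].
Qed.

End TactTheory.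

Local Open Scope ring_scope.

(** * The action on involutions *)

Lemma u_neq0 : u != 0.
Proof. by rewrite /u tofrac_eq0 polyX_eq0. Qed.

Lemma uD1_neq0 : u + 1 != 0.
Proof.
rewrite /u -tofrac1 -tofracD tofrac_eq0 -polyC1 -size_poly_eq0.
by have := size_XaddC (1 : rat); move=> ->.
Qed.

Lemma uB1_neq0 : u - 1 != 0.
Proof.
rewrite /u -tofrac1 -tofracB tofrac_eq0 -polyC1 -size_poly_eq0.
by have := size_XsubC (1 : rat); move=> ->.
Qed.

(** For an involution [w], [T_s a_w] is a combination of [a_w] and the basis vector of this
    involution. On involutions the map is involutive without fixed points, so [T_s] acts on M by 2 x
    2 blocks. *)
Definition twv n (i : 'I_n.-1) (w : 'S_n) : 'S_n :=
  if (sref i * w == w * sref i)%g then (sref i * w)%g else (sref i * w * sref i)%g.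

Lemma twv_invol n (i : 'I_n.-1) (w : Invol n) : (twv i (val w) * twv i (val w) == 1)%g.
Proof.
case: w => w /= /eqP ww; rewrite /twv; case: (sref i * w =P w * sref i)%g => [e|_]; apply/eqP.
  by rewrite {2}e !mulgA -(mulgA (sref i)) ww mulg1 srefK.
by rewrite !mulgA -(mulgA _ (sref i) (sref i)) srefK mulg1 -(mulgA _ w w) ww mulg1 srefK.
Qed.

(* Keeps the bulky [SubType] instance behind [val] out of the goals. *)
Definition iperm n (w : Invol n) : 'S_n := val w.

Definition tw n (i : 'I_n.-1) (w : Invol n) : Invol n := Sub (twv i (iperm w)) (twv_invol i w).

Definition commutes n (i : 'I_n.-1) (w : Invol n) : bool :=
  (sref i * iperm w == iperm w * sref i)%g.
Definition ascent n (i : 'I_n.-1) (w : Invol n) : bool := (pn (iperm w) i < pn (iperm w) i.+1)%N.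

Lemma iperm_tw n (i : 'I_n.-1) (w : Invol n) : iperm (tw i w) = twv i (iperm w).
Proof. by []. Qed.

Lemma pnI n (w : Invol n) x : pn (iperm w) (pn (iperm w) x) = x.
Proof. by rewrite -pnM (eqP (valP w)) pn1. Qed.

Lemma Invol_ext n (v w : Invol n) : pn (iperm v) =1 pn (iperm w) -> v = w.
Proof. by move=> h; exact/val_inj/pn_ext. Qed.

Lemma pn_tw n (i : 'I_n.-1) (w : Invol n) x :
  pn (iperm (tw i w)) x = if commutes i w then pn (iperm w) (sn i x) else sn i (pn (iperm w) (sn i x)).
Proof.
rewrite iperm_tw /twv -/(commutes i w); case: ifP => _; first by rewrite pn_sM.
by rewrite pnM pn_sM pn_sref.
Qed.

Lemma commutes_pn n (i : 'I_n.-1) (w : Invol n) x :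
  commutes i w -> pn (iperm w) (sn i x) = sn i (pn (iperm w) x).
Proof. by move=> /eqP h; rewrite -pn_sM h pnM pn_sref. Qed.

Lemma commutesP n (i : 'I_n.-1) (w : Invol n) :
  reflect ([/\ pn (iperm w) i = i & pn (iperm w) i.+1 = i.+1] \/
           [/\ pn (iperm w) i = i.+1 & pn (iperm w) i.+1 = i]) (commutes i w).
Proof.
have sn_l : sn i i = i.+1 by sn_lia.
have sn_r : sn i i.+1 = i by sn_lia.
have w_inj : pn (iperm w) i <> pn (iperm w) i.+1 by move/pn_inj; lia.
apply: (iffP idP) => [h|h].
  by have := commutes_pn i h; rewrite sn_l; move: w_inj; sn_case; move=> w_inj h'; lia.
apply/eqP/pn_ext => x; rewrite pn_sM pnM pn_sref.
have [->|xi] := eqVneq x i; first by case: h => -[-> e]; rewrite sn_l ?sn_r // e.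
have [->|xi1] := eqVneq x i.+1; first by case: h => -[e ->]; rewrite sn_r ?sn_l // e.
have -> : sn i x = x by sn_lia.
have := @pn_inj n (iperm w) x i; have := @pn_inj n (iperm w) x i.+1.
by case: h => -[-> ->]; sn_lia.
Qed.

(* The coefficient of [a_w] in [T_s m] is [alpha * m w + beta * m (tw w)]: these
   are the rows of the matrix of [T_s], whereas [coefM] gives its columns. *)
Definition alpha n (i : 'I_n.-1) (w : Invol n) : Qu :=
  if commutes i w then (if ascent i w then u else u ^+ 2 - u - 1)
  else (if ascent i w then 0 else u ^+ 2 - 1).
Definition beta n (i : 'I_n.-1) (w : Invol n) : Qu :=
  if commutes i w then (if ascent i w then u ^+ 2 - u else u + 1)
  else (if ascent i w then u ^+ 2 else 1).

Lemma ascent_tw n (i : 'I_n.-1) (w : Invol n) : ascent i (tw i w) = ~~ ascent i w.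
Proof.
have sn_l : sn i i = i.+1 by sn_lia.
have sn_r : sn i i.+1 = i by sn_lia.
have w_inj : pn (iperm w) i <> pn (iperm w) i.+1 by move/pn_inj; lia.
rewrite /ascent !pn_tw sn_l sn_r; case: commutesP => h; first by lia.
by move: h w_inj; sn_case; move=> h w_inj; lia.
Qed.

Lemma commutes_tw n (i : 'I_n.-1) (w : Invol n) : commutes i (tw i w) = commutes i w.
Proof.
rewrite {1}/commutes iperm_tw /twv -/(commutes i w); case: ifP => [/eqP e|h].
  by rewrite -(mulgA _ (iperm w)) -e eqxx.
rewrite [LHS]eq_sym !mulgA srefK mul1g -mulgA srefK mulg1.
exact: h.
Qed.

Lemma twK n (i : 'I_n.-1) : involutive (@tw n i).
Proof.
by move=> w; apply: Invol_ext => x; rewrite !pn_tw commutes_tw; case: (commutes i w); rewrite !snK.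
Qed.

Lemma opME n (i : 'I_n.-1) (m : Mod n) w :
  opM i m w = alpha i w * m w + beta i w * m (tw i w).
Proof.
rewrite ffunE.
have coefE (w' : Invol n) : Defs.coefM i w' w =
    (w == w')%:R * alpha i w' + (w == tw i w')%:R * beta i (tw i w').
  rewrite /Defs.coefM /alpha /beta commutes_tw ascent_tw -!/(iperm _) ltn_coxlen.
  rewrite -/(ascent i w') -/(commutes i w') -(val_eqE w (tw i w')) -!/(iperm _) iperm_tw /twv.
  by rewrite -/(commutes i w'); case: (commutes i w'); case: (ascent i w'); rewrite /= ?mulr0 ?add0r ?mulr1.
under eq_bigr do rewrite coefE mulrDr.
rewrite big_split /=; congr (_ + _).
  rewrite (bigD1 w) //= eqxx mul1r big1 ?addr0; first by rewrite mulrC.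
  by move=> v vw; rewrite eq_sym (negPf vw) mul0r mulr0.
rewrite (bigD1 (tw i w)) //= twK eqxx mul1r big1 ?addr0; first by rewrite mulrC.
move=> v vw; have /negPf -> : w != tw i v by apply: contraNneq vw => ->; rewrite twK.
by rewrite mul0r mulr0.
Qed.

Lemma addM n (m m' : Mod n) w : (m + m') w = m w + m' w :> Qu.
Proof. by rewrite ffunE. Qed.

Lemma scaleM n (a : Qu) (m : Mod n) w : (a *: m) w = a * m w :> Qu.
Proof. by rewrite ffunE. Qed.

Lemma Mod_ext n (m m' : Mod n) : (forall w : Invol n, m w = m' w) -> m = m'.
Proof. by move=> h; apply/ffunP. Qed.

Lemma opM_is_linear n (i : 'I_n.-1) : linear (@opM n i : Mod n -> Mod n).
Proof.
move=> a m m'; apply: Mod_ext => w; rewrite addM scaleM !opME !addM !scaleM.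
by rewrite /GRing.scale /=; ring.
Qed.

HB.instance Definition _ n (i : 'I_n.-1) :=
  GRing.isLinear.Build Qu (Mod n) (Mod n) *:%R (@opM n i) (@opM_is_linear n i).

(** This is the relation (T_s + 1)(T_s - u^2) = 0, checked on each block {w, tw i w}. *)
Lemma opM_quad n (i : 'I_n.-1) (m : Mod n) :
  opM i (opM i m) = (u ^+ 2 - 1) *: opM i m + u ^+ 2 *: m.
Proof.
apply: Mod_ext => w; rewrite addM !scaleM !opME twK /alpha /beta ascent_tw commutes_tw.
by case: (commutes i w); case: (ascent i w) => /=; ring.
Qed.

Lemma sn_l i : sn i i = i.+1. Proof. by sn_lia. Qed.
Lemma sn_r i : sn i i.+1 = i. Proof. by sn_lia. Qed.
Lemma sn_id i x : x != i -> x != i.+1 -> sn i x = x. Proof. by sn_lia. Qed.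
Lemma sn_SS i : sn i i.+2 = i.+2. Proof. by sn_lia. Qed.
Lemma sn_P i : sn i.+1 i = i. Proof. by sn_lia. Qed.
Definition snE := (sn_l, sn_r, sn_SS, sn_P).

(** * Braid relations on M *)

Definition adjacent (i j : nat) : bool := (i.+1 == j) || (j.+1 == i).

Lemma adjacentC i j : adjacent i j = adjacent j i.
Proof. exact: orbC. Qed.

Lemma sn_braid i j x : adjacent i j -> sn i (sn j (sn i x)) = sn j (sn i (sn j x)).
Proof.
have braid k y : sn k (sn k.+1 (sn k y)) = sn k.+1 (sn k (sn k.+1 y)).
  have [->|h1] := eqVneq y k; first by rewrite !snE.
  have [->|h2] := eqVneq y k.+1; first by rewrite !snE.
  have [->|h3] := eqVneq y k.+2; first by rewrite !snE.
  by rewrite !(sn_id h2 h3, sn_id h1 h2).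
by case/orP => /eqP <-.
Qed.

(** In the conjugation case the second factor is on the right; passing to the inverse, which has the
    same number of inversions, turns it into a left factor. *)
Lemma ninv_tw n (i : 'I_n.-1) (w : Invol n) : ascent i w ->
  ninv (iperm (tw i w)) = (ninv (iperm w) + if commutes i w then 1 else 2)%N.
Proof.
move=> hu; rewrite iperm_tw /twv -/(commutes i w); case: commutesP => h; first by rewrite ninv_up // addn1.
have sV : (sref i)^-1%g = sref i by apply: (mulgI (sref i)); rewrite mulgV srefK.
have eV : (iperm w)^-1%g = iperm w.
  by apply: (mulgI (iperm w)); rewrite mulgV (eqP (valP w)).
rewrite -mulgA ninv_up; last by move: hu; rewrite !pnM !pn_sref /ascent; move: h; sn_lia.
by rewrite -(ninvV (_ * _)%g) invMg eV sV ninv_up // addn2.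
Qed.

Lemma ltn_ninv_tw n (i : 'I_n.-1) (w : Invol n) : ~~ ascent i w ->
  (ninv (iperm (tw i w)) < ninv (iperm w))%N.
Proof.
by rewrite -ascent_tw => /ninv_tw; rewrite twK => ->; rewrite commutes_tw; case: ifP; lia.
Qed.

(** The values u + 1 and u^2 - u are not units of Z[u, u^-1], but over Q(u) dividing by [beta]
    recovers [m (tw i w)] from the coordinates of [m] and [opM i m] at [w]. *)
Lemma beta_neq0 n (i : 'I_n.-1) (w : Invol n) : beta i w != 0.
Proof.
have e : u ^+ 2 - u = u * (u - 1) by ring.
rewrite /beta e; case: (commutes i w); case: (ascent i w).
- exact: mulf_neq0 u_neq0 uB1_neq0.
- exact: uD1_neq0.
- exact: expf_neq0 u_neq0.
- exact: oner_neq0.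
Qed.

(* The braid defect [X - Y] satisfies [T_i (X - Y) = (X - Y) (u^2 - 1 - T_k)], so
   the coordinates on which it vanishes are stable under [tw i]; hence the braid
   relations need only be checked at involutions without descents at [i] and [j]. *)
Lemma agree_tw n (i k : 'I_n.-1) (X Y Z : Mod n -> Mod n) (w : Invol n) :
    (forall m, opM i (X m) = (u ^+ 2 - 1) *: X m + u ^+ 2 *: Z m) ->
    (forall m, opM i (Y m) = X (opM k m)) ->
    (forall m, Y (opM k m) = (u ^+ 2 - 1) *: Y m + u ^+ 2 *: Z m) ->
  (forall m, X m w = Y m w) -> forall m, X m (tw i w) = Y m (tw i w).
Proof.
move=> hX hY hYk e m; apply: (mulfI (beta_neq0 i w)).
apply: (addrI (alpha i w * X m w)); rewrite {2}e -!opME hY hX e hYk.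
by rewrite !addM !scaleM e.
Qed.

Lemma opM_commutes_ascent n (i : 'I_n.-1) (m : Mod n) w : commutes i w -> ascent i w ->
  opM i m w = u * m w + (u ^+ 2 - u) * m (tw i w).
Proof. by move=> hc hu; rewrite opME /alpha /beta hc hu. Qed.

Lemma opM_ascent n (i : 'I_n.-1) (m : Mod n) w : ~~ commutes i w -> ascent i w ->
  opM i m w = u ^+ 2 * m (tw i w).
Proof. by move=> /negPf hc hu; rewrite opME /alpha /beta hc hu mul0r add0r. Qed.

Lemma opM_descent n (i : 'I_n.-1) (m : Mod n) w : ~~ commutes i w -> ~~ ascent i w ->
  opM i m w = (u ^+ 2 - 1) * m w + m (tw i w).
Proof. by move=> /negPf hc /negPf hu; rewrite opME /alpha /beta hc hu mul1r. Qed.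

Lemma pn_tw_commutes n (i : 'I_n.-1) (w : Invol n) : commutes i w ->
  forall x, pn (iperm (tw i w)) x = pn (iperm w) (sn i x).
Proof. by move=> h x; rewrite pn_tw h. Qed.

Lemma pn_tw_conj n (i : 'I_n.-1) (w : Invol n) : ~~ commutes i w ->
  forall x, pn (iperm (tw i w)) x = sn i (pn (iperm w) (sn i x)).
Proof. by move=> /negPf h x; rewrite pn_tw h. Qed.

Lemma sn_ltn i x y : (x < y)%N -> ~~ ((x == i) && (y == i.+1)) -> (sn i x < sn i y)%N.
Proof. by sn_lia. Qed.

Lemma sn_eql i x : (sn i x == i) = (x == i.+1).
Proof. by sn_lia. Qed.

Lemma sn_eqr i x : (sn i x == i.+1) = (x == i).
Proof. by sn_lia. Qed.

Lemma sn_eqSS i x : (sn i x == i.+2) = (x == i.+2).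
Proof. by sn_lia. Qed.

Lemma sn_eqP i x : (sn i.+1 x == i) = (x == i).
Proof. by sn_lia. Qed.

Definition sn_eqE := (sn_eql, sn_eqr, sn_eqSS, sn_eqP).

Lemma commutes_ascent n (i : 'I_n.-1) (w : Invol n) : ascent i w ->
  commutes i w = (pn (iperm w) i == i) && (pn (iperm w) i.+1 == i.+1).
Proof.
rewrite /ascent => h; apply/commutesP/andP => [[[-> ->]|[e1 e2]]|[/eqP e1 /eqP e2]]; [by []|lia|by left].
Qed.

Lemma pnI_eq n (w : Invol n) x y : (pn (iperm w) x == y) = (pn (iperm w) y == x).
Proof. by apply/eqP/eqP => <-; rewrite pnI. Qed.

Section Adjacent.
Variables (n : nat) (i j : 'I_n.-1) (w : Invol n).
Hypotheses (ij : adjacent i j) (ui : ascent i w) (uj : ascent j w).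

(** With ascents at adjacent [i] and [j], [w] increases on three consecutive points, and three cases
    occur according to which of the two reflections commute with [w]. If neither does, every step of
    either path of length three is an ascent by conjugation. *)
Lemma free_tw1 : ~~ commutes i w -> ~~ commutes j w -> ascent j (tw i w) && ~~ commutes j (tw i w).
Proof.
move=> ni nj; have u1 : ascent j (tw i w).
  rewrite /ascent !(pn_tw_conj ni).
  move: ui uj; rewrite /ascent.
  by case/orP: ij => /eqP <-; rewrite !snE => h1 h2; apply: sn_ltn; lia.
rewrite u1 commutes_ascent // !(pn_tw_conj ni).
move: ui uj ni nj; rewrite !commutes_ascent // /ascent.
by case/orP: ij => /eqP <-; rewrite !snE !sn_eqE => h1 h2; lia.
Qed.

Lemma free_tw2 : ~~ commutes i w -> ~~ commutes j w ->
  ascent i (tw j (tw i w)) && ~~ commutes i (tw j (tw i w)).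
Proof.
move=> ni nj; have /andP[_ n1] := free_tw1 ni nj; have u2 : ascent i (tw j (tw i w)).
  rewrite /ascent !(pn_tw_conj n1, pn_tw_conj ni).
  move: (pnI_eq w i i.+1) ui uj ni nj; rewrite !commutes_ascent // /ascent.
  case/orP: ij => /eqP <-; rewrite !snE => h0 h1 h2 h3 h4.
    apply: sn_ltn; first by apply: sn_ltn; lia.
    by rewrite !sn_eqE; lia.
  apply: sn_ltn; first by apply: sn_ltn; lia.
  by rewrite !sn_eqE; lia.
rewrite u2 commutes_ascent // !(pn_tw_conj n1, pn_tw_conj ni).
move: (pnI_eq w i i.+1) ui uj ni nj; rewrite !commutes_ascent // /ascent.
by case/orP: ij => /eqP <-; rewrite !snE !sn_eqE => h0 h1 h2; lia.
Qed.
End Adjacent.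

Section Adjacent.
Variables (n : nat) (i j : 'I_n.-1) (w : Invol n).
Hypotheses (ij : adjacent i j) (ui : ascent i w) (uj : ascent j w) (ci : commutes i w).

(** If only [sref i] commutes, [w] fixes just two of the three points. The path j, i, j conjugates
    twice, until the fixed points are [j] and [j.+1], and only then adds a 2-cycle; the path i, j, i
    adds it first. *)
Lemma half_tw1 : ~~ commutes j w -> ascent i (tw j w) && ~~ commutes i (tw j w).
Proof.
move=> nj; have u1 : ascent i (tw j w).
  rewrite /ascent !(pn_tw_conj nj); move: ui uj ci nj; rewrite !commutes_ascent // /ascent.
  by case/orP: ij => /eqP <-; rewrite !snE => h1 h2 h3 h4; apply: sn_ltn; lia.
rewrite u1 commutes_ascent // !(pn_tw_conj nj).
move: ui uj ci nj; rewrite !commutes_ascent // /ascent.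
by case/orP: ij => /eqP <-; rewrite !snE !sn_eqE => h1 h2; lia.
Qed.

Lemma half_tw2 : ~~ commutes j w -> ascent j (tw i (tw j w)) && commutes j (tw i (tw j w)).
Proof.
move=> nj; have /andP[_ n1] := half_tw1 nj; have u2 : ascent j (tw i (tw j w)).
  rewrite /ascent !(pn_tw_conj n1, pn_tw_conj nj); move: ui uj ci nj; rewrite !commutes_ascent // /ascent.
  case/orP: ij => /eqP <-; rewrite !snE => h1 h2 /andP[/eqP -> /eqP ->] h4.
    by rewrite !snE.
  by rewrite !snE.
rewrite u2 commutes_ascent // !(pn_tw_conj n1, pn_tw_conj nj).
move: ui uj ci nj; rewrite !commutes_ascent // /ascent.
by case/orP: ij => /eqP <-; rewrite !snE !sn_eqE => h1 h2; lia.
Qed.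

Lemma half_tw3 : ~~ commutes j w -> ascent j (tw i w) && ~~ commutes j (tw i w).
Proof.
move=> nj; have u1 : ascent j (tw i w).
  rewrite /ascent !(pn_tw_commutes ci); move: ui uj ci nj; rewrite !commutes_ascent // /ascent.
  by case/orP: ij => /eqP <-; rewrite !snE => h1 h2 h3 h4; lia.
rewrite u1 commutes_ascent // !(pn_tw_commutes ci).
move: ui uj ci nj; rewrite !commutes_ascent // /ascent.
by case/orP: ij => /eqP <-; rewrite !snE => h1 h2; lia.
Qed.

Lemma half_tw4 : ~~ commutes j w -> ascent i (tw j (tw i w)) && ~~ commutes i (tw j (tw i w)).
Proof.
move=> nj; have /andP[_ n1] := half_tw3 nj; have u2 : ascent i (tw j (tw i w)).
  rewrite /ascent !(pn_tw_conj n1, pn_tw_commutes ci); move: ui uj ci nj; rewrite !commutes_ascent // /ascent.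
  case/orP: ij => /eqP <-; rewrite !snE => h1 h2 h3 h4.
    by apply: sn_ltn; lia.
  by apply: sn_ltn; lia.
rewrite u2 commutes_ascent // !(pn_tw_conj n1, pn_tw_commutes ci).
move: ui uj ci nj; rewrite !commutes_ascent // /ascent.
by case/orP: ij => /eqP <-; rewrite !snE !sn_eqE => h1 h2; lia.
Qed.

Lemma fixed_tw : commutes j w -> ascent j (tw i w) && ~~ commutes j (tw i w).
Proof.
move=> cj; have u1 : ascent j (tw i w).
  rewrite /ascent !(pn_tw_commutes ci); move: ui uj ci cj; rewrite !commutes_ascent // /ascent.
  by case/orP: ij => /eqP <-; rewrite !snE => h1 h2 h3 h4; lia.
rewrite u1 commutes_ascent // !(pn_tw_commutes ci).
move: ui uj ci cj; rewrite !commutes_ascent // /ascent.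
by case/orP: ij => /eqP <-; rewrite !snE => h1 h2; lia.
Qed.

End Adjacent.

Lemma braid_up_free n (i j : 'I_n.-1) (w : Invol n) (m : Mod n) :
    adjacent i j -> ascent i w -> ascent j w -> ~~ commutes i w -> ~~ commutes j w ->
  opM i (opM j (opM i m)) w = u ^+ 6 * m (tw i (tw j (tw i w))).
Proof.
move=> ij ui uj ni nj; have /andP[u1 n1] := free_tw1 ij ui uj ni nj.
have /andP[u2 n2] := free_tw2 ij ui uj ni nj.
by rewrite !opM_ascent //; ring.
Qed.

Lemma tw_braid_free n (i j : 'I_n.-1) (w : Invol n) :
    adjacent i j -> ascent i w -> ascent j w -> ~~ commutes i w -> ~~ commutes j w ->
  tw i (tw j (tw i w)) = tw j (tw i (tw j w)).
Proof.
move=> ij ui uj ni nj; have /andP[_ n1] := free_tw1 ij ui uj ni nj.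
have /andP[_ n2] := free_tw2 ij ui uj ni nj.
rewrite adjacentC in ij; have /andP[_ n3] := free_tw1 ij uj ui nj ni.
have /andP[_ n4] := free_tw2 ij uj ui nj ni.
apply: Invol_ext => x.
rewrite !(pn_tw_conj n2, pn_tw_conj n1, pn_tw_conj ni).
by rewrite !(pn_tw_conj n4, pn_tw_conj n3, pn_tw_conj nj) !(sn_braid _ ij).
Qed.

Lemma braid_up_half n (i j : 'I_n.-1) (w : Invol n) (m : Mod n) :
    adjacent i j -> ascent i w -> ascent j w -> commutes i w -> ~~ commutes j w ->
  opM i (opM j (opM i m)) w = opM j (opM i (opM j m)) w.
Proof.
move=> ij ui uj ci nj.
have /andP[u1 n1] := half_tw1 ij ui uj ci nj; have /andP[u2 c2] := half_tw2 ij ui uj ci nj.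
have /andP[u3 n3] := half_tw3 ij ui uj ci nj; have /andP[u4 n4] := half_tw4 ij ui uj ci nj.
have e : tw j (tw i (tw j w)) = tw i (tw j (tw i w)).
  apply: Invol_ext => x.
  rewrite (pn_tw_commutes c2) !(pn_tw_conj n1, pn_tw_conj nj).
  by rewrite !(pn_tw_conj n4, pn_tw_conj n3) (pn_tw_commutes ci) (sn_braid _ ij).
rewrite (opM_commutes_ascent _ ci ui) !(opM_ascent _ nj uj, opM_ascent _ n3 u3).
rewrite !(opM_ascent _ n1 u1, opM_ascent _ n4 u4) (opM_commutes_ascent _ c2 u2) e.
ring.
Qed.

(** All three points are fixed, and the involutions reached are [w] times the four elements of
    square 1 in the symmetric group on them; both paths of length two end at the longest one. *)
Lemma braid_up_fixed n (i j : 'I_n.-1) (w : Invol n) (m : Mod n) :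
    adjacent i j -> ascent i w -> ascent j w -> commutes i w -> commutes j w ->
  opM i (opM j (opM i m)) w = opM j (opM i (opM j m)) w.
Proof.
move=> ij ui uj ci cj; have ji : adjacent j i by rewrite adjacentC.
have /andP[u1 n1] := fixed_tw ij ui uj ci cj; have /andP[u2 n2] := fixed_tw ji uj ui cj ci.
have e : tw i (tw j w) = tw j (tw i w).
  apply: Invol_ext => x.
  rewrite (pn_tw_conj n1) (pn_tw_commutes ci) (pn_tw_conj n2) (pn_tw_commutes cj).
  by rewrite !(commutes_pn _ ci, commutes_pn _ cj) (sn_braid _ ij).
have ei : tw i (tw j (tw i w)) = tw j w by rewrite -e twK.
have ej : tw j (tw i (tw j w)) = tw i w by rewrite e twK.
have [dn dc] : ~~ ascent i (tw j (tw i w)) /\ ~~ commutes i (tw j (tw i w)).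
  by rewrite -e ascent_tw commutes_tw u2.
have [dn' dc'] : ~~ ascent j (tw j (tw i w)) /\ ~~ commutes j (tw j (tw i w)).
  by rewrite ascent_tw commutes_tw u1.
rewrite (opM_commutes_ascent (opM j _) ci ui) (opM_commutes_ascent (opM i _) cj uj).
rewrite !(opM_commutes_ascent _ cj uj, opM_commutes_ascent _ ci ui).
rewrite !(opM_ascent _ n1 u1, opM_ascent _ n2 u2) e.
rewrite (opM_descent _ dc dn) (opM_descent _ dc' dn') ei twK.
ring.
Qed.

Lemma opM_comb n (i : 'I_n.-1) (a b : Qu) (m m' : Mod n) :
  opM i (a *: m + b *: m') = a *: opM i m + b *: opM i m'.
Proof. by rewrite linearP linearZ. Qed.

Lemma opM_braid n (i j : 'I_n.-1) (m : Mod n) : adjacent i j ->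
  opM i (opM j (opM i m)) = opM j (opM i (opM j m)).
Proof.
move=> ij; have ji : adjacent j i by rewrite adjacentC.
apply: Mod_ext => w; have [k] := ubnP (ninv (iperm w)); elim: k w m => [|k IH] w m hk.
  by rewrite ltn0 in hk.
have [ui|/[dup] ui /ltn_ninv_tw lt_w] := boolP (ascent i w); last first.
  rewrite -(twK i w).
  (* [X] and [Y] are the two braid words; T_i Y = X T_j holds since both are T_i T_j T_i T_j. *)
  apply: (@agree_tw n i j (fun m => opM i (opM j (opM i m))) (fun m => opM j (opM i (opM j m)))
    (fun m => opM j (opM i m))) => {}m.
  - exact: opM_quad.
  - by [].
  - by rewrite opM_quad !opM_comb.
  - by apply: IH; lia.
have [uj|/[dup] uj /ltn_ninv_tw lt_w] := boolP (ascent j w); last first.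
  rewrite -(twK j w); apply: esym.
  apply: (@agree_tw n j i (fun m => opM j (opM i (opM j m))) (fun m => opM i (opM j (opM i m)))
    (fun m => opM i (opM j m))) => {}m.
  - exact: opM_quad.
  - by [].
  - by rewrite opM_quad !opM_comb.
  - by apply: esym; apply: IH; lia.
have [ci|ni] := boolP (commutes i w); have [cj|nj] := boolP (commutes j w).
- exact: braid_up_fixed.
- exact: braid_up_half.
- by apply: esym; apply: braid_up_half.
- by rewrite !braid_up_free // tw_braid_free.
Qed.

(** * Commutation relations on M *)

Definition far (i j : nat) : bool := (i.+1 < j)%N || (j.+1 < i)%N.

Lemma sn_far i j : far i j -> sn i j = j /\ sn i j.+1 = j.+1.
Proof. by rewrite /far => h; split; sn_lia. Qed.

Lemma sn_comm i j x : far i j -> sn i (sn j x) = sn j (sn i x).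
Proof. by rewrite /far => h; sn_lia. Qed.

Section Far.
Variables (n : nat) (i j : 'I_n.-1) (w : Invol n).
Hypotheses (ij : far i j) (ui : ascent i w) (uj : ascent j w).

(** Conjugation by [w] exchanges s_i and s_j, so w s_i = s_j w and both s_i w s_i and s_j w s_j
    equal s_i s_j w. This is the only case in which the two reflections interact. *)
Lemma far_swap : pn (iperm w) i = j -> pn (iperm w) i.+1 = j.+1 ->
  [/\ tw i w = tw j w, ~~ commutes i w & ~~ commutes j w].
Proof.
move=> e1 e2; have ni : ~~ commutes i w by rewrite commutes_ascent // e1 e2; move: ij; rewrite /far; lia.
have f1 : pn (iperm w) j = i by rewrite -e1 pnI.
have f2 : pn (iperm w) j.+1 = i.+1 by rewrite -e2 pnI.
have nj : ~~ commutes j w by rewrite commutes_ascent // f1 f2; move: ij; rewrite /far; lia.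
split=> //; have g x : pn (iperm w) (sn i x) = sn j (pn (iperm w) x).
  have [->|h1] := eqVneq x i; first by rewrite sn_l e1 e2 sn_l.
  have [->|h2] := eqVneq x i.+1; first by rewrite sn_r e1 e2 sn_r.
  rewrite !sn_id //.
    by rewrite -e1 (inj_eq (@pn_inj _ _)).
  by rewrite -e2 (inj_eq (@pn_inj _ _)).
have g' x : pn (iperm w) (sn j x) = sn i (pn (iperm w) x).
  by rewrite -{1}(pnI w x) -g pnI.
by apply: Invol_ext => x; rewrite (pn_tw_conj ni) (pn_tw_conj nj) g g' (sn_comm _ ij).
Qed.

Lemma far_pres : ~~ ((pn (iperm w) i == j) && (pn (iperm w) i.+1 == j.+1)) ->
  ascent j (tw i w) /\ commutes j (tw i w) = commutes j w.
Proof.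
move=> ne; have [e1 e2] := sn_far ij.
have u1 : ascent j (tw i w).
  rewrite /ascent !pn_tw e1 e2; case: ifP => // _; apply: sn_ltn => //.
  by rewrite (pnI_eq w j) (pnI_eq w j.+1).
split=> //; rewrite !commutes_ascent // !pn_tw e1 e2; case: ifP => // _.
have s1 y : (sn i y == j) = (y == j) by rewrite -{1}e1 (inj_eq (can_inj (snK i))).
have s2 y : (sn i y == j.+1) = (y == j.+1) by rewrite -{1}e2 (inj_eq (can_inj (snK i))).
by rewrite s1 s2.
Qed.

End Far.

Lemma opM_comm n (i j : 'I_n.-1) (m : Mod n) : far i j ->
  opM i (opM j m) = opM j (opM i m).
Proof.
move=> ij; have ji : far j i by move: ij; rewrite /far orbC.
apply: Mod_ext => w; have [k] := ubnP (ninv (iperm w)); elim: k w m => [|k IH] w m hk.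
  by rewrite ltn0 in hk.
have [ui|/[dup] ui /ltn_ninv_tw lt_w] := boolP (ascent i w); last first.
  rewrite -(twK i w).
  apply: (@agree_tw n i i (fun m => opM i (opM j m)) (fun m => opM j (opM i m)) (@opM n j)) => {}m.
  - exact: opM_quad.
  - by [].
  - by rewrite opM_quad opM_comb.
  - by apply: IH; lia.
have [uj|/[dup] uj /ltn_ninv_tw lt_w] := boolP (ascent j w); last first.
  rewrite -(twK j w); apply: esym.
  apply: (@agree_tw n j j (fun m => opM j (opM i m)) (fun m => opM i (opM j m)) (@opM n i)) => {}m.
  - exact: opM_quad.
  - by [].
  - by rewrite opM_quad opM_comb.
  - by apply: esym; apply: IH; lia.
have [/andP[/eqP e1 /eqP e2]|ne] := boolP ((pn (iperm w) i == j) && (pn (iperm w) i.+1 == j.+1)).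
  have [e ni nj] := far_swap ij ui uj e1 e2.
  rewrite (opM_ascent _ ni ui) (opM_ascent _ nj uj) -e.
  rewrite (opM_descent (i := i)) ?commutes_tw ?ascent_tw ?ui // twK.
  by rewrite e (opM_descent (i := j)) ?commutes_tw ?ascent_tw ?uj // twK.
have ne' : ~~ ((pn (iperm w) j == i) && (pn (iperm w) j.+1 == i.+1)).
  by rewrite (pnI_eq w j) (pnI_eq w j.+1).
have [u1 c1] := far_pres ij uj ne; have [u2 c2] := far_pres ji ui ne'.
have e : tw i (tw j w) = tw j (tw i w).
  apply: Invol_ext => x; rewrite !pn_tw c1 c2.
  by case: (commutes i w); case: (commutes j w); rewrite !(sn_comm _ ij).
rewrite !opME /alpha /beta c1 c2 ui uj u1 u2 e.
by case: (commutes i w); case: (commutes j w); ring.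
Qed.

(** * The orbit of the generator *)

Definition Ta1 n (x : 'S_n) : Mod n := Tact (@opM n) x (a1 n).

Lemma Ta1_1 n : Ta1 (1%g : 'S_n) = a1 n.
Proof. exact: Tact1. Qed.

Lemma Ta1_down n (x : 'S_n) (i : 'I_n.-1) : (pn x i.+1 < pn x i)%N ->
  Ta1 x = opM i (Ta1 (sref i * x)%g).
Proof.
apply: Tact_down => {}i j v ij; first by apply: opM_comm; rewrite /far ij.
by apply: opM_braid; rewrite /adjacent ij eqxx.
Qed.

Lemma Ta1_up n (x : 'S_n) (i : 'I_n.-1) : (pn x i < pn x i.+1)%N ->
  opM i (Ta1 x) = Ta1 (sref i * x)%g.
Proof.
move=> h; have hd : (pn (sref i * x)%g i.+1 < pn (sref i * x)%g i)%N by rewrite !pn_sM sn_l sn_r.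
by rewrite (Ta1_down hd) srefKl.
Qed.

(** A reduced word of [x] uses only reflections moving points below [p], and each such [T_i]
    preserves the span of the [a_w] with [w] fixing every point from [p] on. *)
Lemma Ta1_supp n p (x : 'S_n) (w : Invol n) q :
    (forall r, (p <= r)%N -> pn x r = r) -> (p <= q)%N -> pn (iperm w) q != q ->
  Ta1 x w = 0.
Proof.
have [k] := ubnP (ninv x); elim: k x w => [|k IH] x w hk; first by rewrite ltn0 in hk.
move=> fix_x pq wq; have [x1|/ex_descent[i hi]] := eqVneq x 1%g.
  rewrite x1 Ta1_1 ffunE; case: eqP => // e.
  by rewrite /iperm e pn1 eqxx in wq.
have lt_ip : (i.+1 < p)%N.
  rewrite ltnNge; apply/negP => h; rewrite (fix_x i.+1 h) in hi.
  have := fix_x (pn x i); have := @pn_inj n x (pn x i) i; lia.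
have lt_k : (ninv (sref i * x)%g < k)%N by have := ninv_down hi; lia.
have sq : sn i q = q by apply: sn_id; lia.
have fix_sx r : (p <= r)%N -> pn (sref i * x)%g r = r.
  by move=> h; rewrite pn_sM sn_id ?fix_x //; lia.
rewrite (Ta1_down hi) opME !(IH (sref i * x)%g) ?mulr0 ?addr0 // pn_tw sq.
by case: ifP => // _; rewrite -{2}sq (inj_eq (can_inj (snK i))).
Qed.

(* The hypotheses on [w] say that it is the transposition [(j k)]. *)
Lemma Ta1_transp n p k j (x : 'S_n) (w : Invol n) :
    (forall r, (p < r)%N -> pn x r = r) -> pn x k = p -> (j < k)%N ->
    pn (iperm w) j = k -> (forall r, r != j -> r != k -> pn (iperm w) r = r) ->
  Ta1 x w = 0.
Proof.
have [d] := ubnP (p - k); elim: d k x w => [|d IH] k x w hd fix_x xk jk wj fix_w; first by rewrite ltn0 in hd.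
have wk : pn (iperm w) k = j by rewrite -wj pnI.
have kp : (k <= p)%N by rewrite leqNgt; apply/negP => h; have := fix_x k h; lia.
move: kp; rewrite leq_eqVlt => /orP[/eqP kp|kp].
  (* If [k = p], then [x] fixes every point from [p] on, while [w] moves [p]. *)
  apply: (@Ta1_supp _ k _ _ k); rewrite ?wk ?leqnn //; last by lia.
  move=> r; rewrite leq_eqVlt => /orP[/eqP <-|]; first by rewrite xk.
  by rewrite kp; apply: fix_x.
have kn : (k < n.-1)%N.
  have := pn_lt x k; have := pn_out x (x := k); rewrite xk; lia.
pose i : 'I_n.-1 := Ordinal kn.
have lt_p : (pn x k.+1 < p)%N.
  have := fix_x (pn x k.+1); have := @pn_inj n x (pn x k.+1) k.+1; have := @pn_inj n x k k.+1; lia.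
have hi : (pn x i.+1 < pn x i)%N by rewrite /= xk.
have wk1 : pn (iperm w) k.+1 = k.+1 by apply: fix_w; lia.
have ui : ascent i w by rewrite /ascent /= wk wk1; lia.
have ni : ~~ commutes i w by rewrite commutes_ascent //= wk; lia.
(* The coefficient at (j k) is u^2 times that of [Ta1 (sref i * x)] at (j k+1), and [sref i * x]
   sends [k.+1] to [p]. *)
rewrite (Ta1_down hi) (opM_ascent _ ni ui) (IH k.+1) ?mulr0 //.
- by lia.
- by move=> r pr; rewrite pn_sM sn_id ?fix_x //=; lia.
- by rewrite pn_sM sn_r.
- by rewrite ltnS ltnW.
- by rewrite (pn_tw_conj ni) (@sn_id i j) ?wj ?sn_l //=; lia.
move=> r rj rk; rewrite (pn_tw_conj ni); have [->|rk'] := eqVneq r k.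
  by rewrite sn_l wk1 sn_r.
by rewrite (@sn_id i r) //= fix_w // sn_id.
Qed.

Lemma invol1_subproof n : ((1 : 'S_n) * 1 == 1)%g.
Proof. by rewrite mulg1. Qed.
Definition invol1 n : Invol n := exist _ 1%g (invol1_subproof n).

Lemma pn_invol1 n x : pn (iperm (invol1 n)) x = x.
Proof. exact: pn1. Qed.

(* Strip from [x] the descent at [x^-1 p], where [p] is the largest point moved by [x]. *)
Lemma Ta1_I1 n (x : 'S_n) : Ta1 x (invol1 n) = u ^+ ninv x.
Proof.
have [k] := ubnP (ninv x); elim: k x => [|k IH] x hk; first by rewrite ltn0 in hk.
have [->|x1] := eqVneq x 1%g; first by rewrite Ta1_1 ffunE eqxx ninv1.
have /existsP[p0 hp0] : [exists p : 'I_n, x p != p].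
  apply: contraR x1; rewrite negb_exists => /forallP h.
  by apply/eqP/permP => p; rewrite perm1; apply/eqP; rewrite -[_ == _]negbK; apply: h.
have [p hp max_p] : exists2 p : 'I_n, x p != p & forall q : 'I_n, x q != q -> (q <= p)%N.
  by case: (@arg_maxnP _ p0 (fun p => x p != p) (@nat_of_ord n) hp0) => p; exists p.
have fix_x r : (p < r)%N -> pn x r = r.
  move=> pr; case: (ltnP r n) => rn; last exact: pn_out.
  rewrite (pnE x (Ordinal rn)); have [->//|/max_p /=] := eqVneq (x (Ordinal rn)) (Ordinal rn); lia.
pose k0 := pn x^-1%g p; have xk : pn x k0 = p by exact: pnKV.
have k0p : k0 != p by apply: contraNneq hp => e; rewrite -val_eqE /= -pnE -{1}e xk.
have kp : (k0 < p)%N by rewrite ltnNge leq_eqVlt eq_sym (negPf k0p); apply/negP => /= /fix_x; lia.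
have kn : (k0 < n.-1)%N by have := ltn_ord p; lia.
pose i : 'I_n.-1 := Ordinal kn.
have lt_p : (pn x k0.+1 < p)%N.
  have := fix_x (pn x k0.+1); have := @pn_inj n x (pn x k0.+1) k0.+1; have := @pn_inj n x k0 k0.+1; lia.
have hi : (pn x i.+1 < pn x i)%N by rewrite /= xk.
have ui : ascent i (invol1 n) by rewrite /ascent !pn_invol1.
have ci : commutes i (invol1 n) by rewrite commutes_ascent // !pn_invol1 !eqxx.
have e := ninv_down hi.
rewrite (Ta1_down hi) (opM_commutes_ascent _ ci ui) IH; last by lia.
(* The other term is the coefficient of [Ta1 (sref i * x)] at the transposition (k0 k0+1), which
   vanishes. *)
rewrite (@Ta1_transp n p k0.+1 k0) ?mulr0 ?addr0 ?e ?exprS //.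
- by move=> r pr; rewrite pn_sM sn_id ?fix_x //=; lia.
- by rewrite pn_sM sn_r.
- by rewrite (pn_tw_commutes ci) pn_invol1 sn_l.
by move=> r rk rk1; rewrite (pn_tw_commutes ci) pn_invol1 sn_id.
Qed.

(** * The invariant form *)

Definition moved n (w : 'S_n) := #|[set p : 'I_n | w p != p]|.

(** At a commuting ascent [tw] adds the 2-cycle (i i+1); otherwise it is a conjugation and keeps the
    cycle type. *)
Lemma moved_tw n (i : 'I_n.-1) (w : Invol n) : ascent i w ->
  moved (iperm (tw i w)) = (moved (iperm w) + if commutes i w then 2 else 0)%N.
Proof.
move=> ui; pose a := Ordinal (ltnW (ltn_iS i)); pose b := Ordinal (ltn_iS i).
rewrite /moved; have [ci|ni] := boolP (commutes i w).
  have ab : a != b by rewrite -val_eqE /=; lia.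
  move: ci (ci); rewrite {1}commutes_ascent // => /andP[wa wb] ci.
  rewrite addnC -[2%N in RHS](_ : #|[set a; b]| = 2%N); last by rewrite cards2 ab.
  rewrite -cardsUI [_ :&: _](_ : _ = set0) ?cards0 ?addn0; last first.
    apply/setP => p; rewrite !inE -!val_eqE /= -pnE.
    have [->|pa] := eqVneq (p : nat) i; first by rewrite wa.
    by have [->|//] := eqVneq (p : nat) i.+1; rewrite wb.
  apply: eq_card => p; rewrite !inE -!val_eqE /= -!pnE (pn_tw_commutes ci).
  have [->|pa] := eqVneq (p : nat) i; first by rewrite sn_l (eqP wb); lia.
  have [->|pb] := eqVneq (p : nat) i.+1; first by rewrite sn_r (eqP wa); lia.
  by rewrite sn_id.
rewrite addn0 -[RHS](card_preimset _ (@perm_inj _ (sref i))); apply: eq_card => p.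
rewrite !inE -!val_eqE /= -!pnE pn_sref (pn_tw_conj ni).
by rewrite (can2_eq (snK i) (snK i)).
Qed.

(** The second exponent counts the 2-cycles of [w]. Self-adjointness forces the formula up to a
    scalar: along an ascent the weight has to change by the ratio of [beta i w] to
    [beta i (tw i w)], which is u (u - 1) / (u + 1) or u^2. *)
Definition weight n (w : Invol n) : Qu :=
  u ^+ ninv (iperm w) * ((u - 1) / (u + 1)) ^+ (moved (iperm w))./2.

Lemma weight_neq0 n (w : Invol n) : weight w != 0.
Proof.
apply: mulf_neq0; first exact: expf_neq0 u_neq0.
apply: expf_neq0; apply: mulf_neq0 uB1_neq0 _; rewrite invr_eq0; exact: uD1_neq0.
Qed.

Lemma weight_I1 n : weight (invol1 n) = 1.
Proof.
rewrite /weight [iperm _]/(1%g) ninv1 /moved (_ : [set p | _] = set0) ?cards0 ?mulr1 //.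
by apply/setP => p; rewrite !inE perm1 eqxx.
Qed.

Lemma weight_tw_ascent n (i : 'I_n.-1) (w : Invol n) : ascent i w ->
  weight (tw i w) * beta i (tw i w) = weight w * beta i w.
Proof.
move=> ui; rewrite /weight /beta ascent_tw commutes_tw ui /= ninv_tw // moved_tw //.
case: (commutes i w); last by rewrite addn0 exprD mulr1 [RHS]mulrAC.
rewrite addn2 /= exprS addn1 exprS.
have := mulfVK uD1_neq0 (u - 1).
move: (_ / _) => k; move: (k ^+ _) (u ^+ ninv _) => c d hk.
by transitivity (u * d * c * (k * (u + 1))); [|rewrite hk]; ring.
Qed.

(** This symmetry of the weighted off-diagonal entries of [T_s] is what makes it self-adjoint. *)
Lemma weight_tw n (i : 'I_n.-1) (w : Invol n) :
  weight (tw i w) * beta i (tw i w) = weight w * beta i w.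
Proof.
have [/weight_tw_ascent //|nu] := boolP (ascent i w).
by rewrite -{3 4}(twK i w) [RHS]weight_tw_ascent // ascent_tw.
Qed.

Definition form n (m m' : Mod n) : Qu := \sum_(w : Invol n) weight w * m w * m' w.

Lemma form_adj n (i : 'I_n.-1) (m m' : Mod n) : form (opM i m) m' = form m (opM i m').
Proof.
rewrite /form.
transitivity (\sum_(w : Invol n) (weight w * alpha i w * m w * m' w) +
              \sum_(w : Invol n) (weight w * beta i w * m (tw i w) * m' w)).
  by rewrite -big_split /=; apply: eq_bigr => w _; rewrite opME; ring.
rewrite [X in _ + X](reindex_inj (can_inj (@twK n i))) -big_split /=.
by apply: eq_bigr => w _; rewrite opME twK weight_tw; ring.
Qed.

Lemma form_linear n (m : Mod n) a m1 m2 : form m (a *: m1 + m2) = a * form m m1 + form m m2.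
Proof.
rewrite /form big_distrr -big_split /=; apply: eq_bigr => w _.
by rewrite addM scaleM; ring.
Qed.

Lemma formC n (m m' : Mod n) : form m m' = form m' m.
Proof. by apply: eq_bigr => w _; ring. Qed.

(* Locked: unification would otherwise unfold it at every [ffun] lemma. *)
HB.lock Definition basisM n (w : Invol n) : Mod n := [ffun v => (v == w)%:R].

Lemma basisE n (w v : Invol n) : basisM w v = (v == w)%:R :> Qu.
Proof. by rewrite basisM.unlock ffunE. Qed.

Lemma form_basis n (w : Invol n) (m : Mod n) : form (basisM w) m = weight w * m w.
Proof.
rewrite /form (bigD1 w) //= basisE eqxx mulr1 big1 ?addr0 // => v /negPf vw.
by rewrite basisE vw mulr0 mul0r.
Qed.

Lemma a1E n : a1 n = basisM (invol1 n).
Proof. by apply: Mod_ext => w; rewrite basisE ffunE. Qed.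

(** * Cyclicity of M *)

Definition cyclicM n (m : Mod n) := exists h : Hecke n, m = Haction (@opM n) h (a1 n).

Lemma cyclic_comb n a (m m' : Mod n) : cyclicM m -> cyclicM m' -> cyclicM (a *: m + m').
Proof.
move=> [h ->] [h' ->]; exists (a *: h + h').
rewrite /Haction scaler_sumr -big_split /=; apply: eq_bigr => x _.
by rewrite !ffunE scalerDl scalerA.
Qed.

Lemma cyclic0 n : cyclicM (0 : Mod n).
Proof.
by exists 0; rewrite /Haction big1 // => x _; rewrite ffunE scale0r.
Qed.

Lemma cyclic_Ta1 n (x : 'S_n) : cyclicM (Ta1 x).
Proof.
exists (Tb x); rewrite /Haction (bigD1 x) //= ffunE eqxx scale1r big1 ?addr0 //.
by move=> y /negPf yx; rewrite ffunE yx scale0r.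
Qed.

Lemma opMZ n (i : 'I_n.-1) (a : Qu) (m : Mod n) : opM i (a *: m) = a *: opM i m.
Proof. exact: linearZ. Qed.

(** On [Ta1 x], [T_i] gives [Ta1 (sref i * x)] at an ascent; at a descent a factor [T_i] is split
    off [Ta1 x] and the quadratic relation applies. *)
Lemma cyclic_op n (i : 'I_n.-1) (m : Mod n) : cyclicM m -> cyclicM (opM i m).
Proof.
move=> [h ->]; rewrite /Haction linear_sum /=.
apply: (big_ind (@cyclicM n)) => [|m1 m2 h1 h2|x _]; first exact: cyclic0.
  by rewrite -[m1]scale1r; apply: cyclic_comb.
rewrite opMZ -[X in cyclicM X]addr0; apply: cyclic_comb; last exact: cyclic0.
rewrite -/(Ta1 x); have [hu|] := boolP (pn x i < pn x i.+1)%N.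
  by rewrite Ta1_up //; apply: cyclic_Ta1.
rewrite -descentE => hd; rewrite (Ta1_down hd) opM_quad -(Ta1_down hd).
apply: cyclic_comb; first exact: cyclic_Ta1.
by rewrite -[X in cyclicM X]addr0; apply: cyclic_comb; [exact: cyclic_Ta1|exact: cyclic0].
Qed.

(** At a descent [i] of [w] the involution [tw i w] is shorter, and [T_i] applied to its basis
    vector contains [a_w] with the nonzero coefficient [beta i w], so [a_w] can be solved for. *)
Lemma cyclic_basis n (w : Invol n) : cyclicM (basisM w).
Proof.
have [k] := ubnP (ninv (iperm w)); elim: k w => [|k IH] w hk; first by rewrite ltn0 in hk.
have [w1|/ex_descent[i hi]] := eqVneq (iperm w) 1%g.
  have -> : w = invol1 n by apply: val_inj.
  by rewrite -a1E -Ta1_1; apply: cyclic_Ta1.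
have nu : ~~ ascent i w by rewrite /ascent -descentE.
have cw : cyclicM (basisM (tw i w)) by apply: IH; have := ltn_ninv_tw nu; lia.
have e : opM i (basisM (tw i w)) = alpha i (tw i w) *: basisM (tw i w) + beta i w *: basisM w.
  apply: Mod_ext => v; rewrite [LHS]opME [RHS]addM.
  rewrite [X in _ = X + _]scaleM [X in _ = _ + X]scaleM !basisE (inj_eq (can_inj (@twK n i))).
  have [->|_] := eqVneq v (tw i w); last by rewrite !mulr0; have [->|_] := eqVneq v w; rewrite ?mulr0.
  by congr (_ + _); have [->|_] := eqVneq (tw i w) w; rewrite ?mulr0.
have -> : basisM w = (beta i w)^-1 *: (- alpha i (tw i w) *: basisM (tw i w) + opM i (basisM (tw i w))) + 0.
  by rewrite e scaleNr addKr scalerA mulVf ?scale1r ?addr0 ?beta_neq0.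
apply: cyclic_comb; last exact: cyclic0.
by apply: cyclic_comb => //; apply: cyclic_op.
Qed.

Lemma cyclic_all n (m : Mod n) : cyclicM m.
Proof.
have -> : m = \sum_(w : Invol n) m w *: basisM w.
  apply: Mod_ext => v; rewrite sum_ffunE; under eq_bigr do rewrite scaleM basisE.
  rewrite (bigD1 v) //= eqxx mulr1 big1 ?addr0 // => w; rewrite eq_sym => /negPf ->.
  by rewrite mulr0.
apply: (big_ind (@cyclicM n)) => [|m1 m2 h1 h2|w _]; first exact: cyclic0.
  by rewrite -[m1]scale1r; apply: cyclic_comb.
by rewrite -[X in cyclicM X]addr0; apply: cyclic_comb; [exact: cyclic_basis|exact: cyclic0].
Qed.

(** * The isomorphism *)

(** The adjoint of the map h |-> h a_1, when the basis [T_x] of the Hecke algebra is made orthogonal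
    with norms u^(2 l(x)); left multiplication by [T_s] is self-adjoint for that form as well. *)
Definition etaM n (m : Mod n) : Hecke n := [ffun x => u ^- (2 * ninv x) * form (Ta1 x) m].

Lemma etaME n (m : Mod n) (x : 'S_n) : etaM m x = u ^- (2 * ninv x) * form (Ta1 x) m :> Qu.
Proof. exact: ffunE. Qed.

Lemma etaM_is_linear n : linear (@etaM n : Mod n -> Hecke n).
Proof.
move=> a m m'; apply/ffunP => x; rewrite !ffunE form_linear /GRing.scale /=; ring.
Qed.

HB.instance Definition _ n :=
  GRing.isLinear.Build Qu (Mod n) (Hecke n) *:%R (@etaM n) (@etaM_is_linear n).

Lemma opHE n (i : 'I_n.-1) (h : Hecke n) (x : 'S_n) :
  opH i h x = if (pn x i < pn x i.+1)%N then u ^+ 2 * h (sref i * x)%g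
              else (u ^+ 2 - 1) * h x + h (sref i * x)%g.
Proof.
pose asc (w : 'S_n) := (pn w i < pn w i.+1)%N.
have asc_s w : asc (sref i * w)%g = ~~ asc w.
  by rewrite /asc !pn_sM sn_l sn_r descentE.
have coefE w : coefH i w x = (w == x)%:R * (if asc w then 0 else u ^+ 2 - 1)
                 + (w == (sref i * x)%g)%:R * (if asc w then 1 else u ^+ 2).
  have e : (w == (sref i * x)%g) = (x == (sref i * w)%g).
    by apply/eqP/eqP => ->; rewrite srefKl.
  rewrite /coefH ltn_coxlen -/(asc w) (eq_sym x w) e.
  by case: (asc w); rewrite ?mulr0 ?add0r ?mulr1.
rewrite ffunE; under eq_bigr do rewrite coefE mulrDr.
rewrite big_split /= -/(asc x).
rewrite (bigD1 x) //= eqxx mul1r big1 ?addr0; last by move=> w /negPf ->; rewrite mul0r mulr0.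
rewrite (bigD1 (sref i * x)%g) //= eqxx mul1r big1 ?addr0; last by move=> w /negPf ->; rewrite mul0r mulr0.
by rewrite asc_s; case: (asc x) => /=; [rewrite mulr0 add0r mulrC|rewrite mulr1 mulrC].
Qed.

(** Self-adjointness moves [T_i] onto [T_x a_1]; the factors u^2 of the Hecke product are absorbed
    by the change of length in the power of u. *)
Lemma etaM_op n (i : 'I_n.-1) (m : Mod n) : etaM (opM i m) = opH i (etaM m).
Proof.
have u2 : u ^+ 2 != 0 by exact: expf_neq0 u_neq0.
have e k : u ^- (2 * k) = u ^+ 2 * u ^- (2 * k.+1).
  by rewrite mulnS exprD invfM mulrA mulfV // mul1r.
apply/ffunP => x; rewrite opHE !etaME -form_adj.
case: ifP => h; first by rewrite Ta1_up // ninv_up // mulrA -e.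
have hd : (pn x i.+1 < pn x i)%N by rewrite descentE h.
rewrite (Ta1_down hd) opM_quad -(Ta1_down hd) formC form_linear !(formC m) (ninv_down hd).
have -> : form (u ^+ 2 *: Ta1 (sref i * x)%g) m = u ^+ 2 * form (Ta1 (sref i * x)%g) m.
  by rewrite formC -[_ *: _]addr0 form_linear formC {2}/form big1 ?addr0 // => w _; rewrite ffunE mulr0.
by rewrite (e (ninv (sref i * x)%g)); ring.
Qed.

(** As [a_1] has weight 1, its pairing with [T_x a_1] is the coefficient u^l(x), and u^(-2 l(x))
    u^l(x) = u^(-l(x)). *)
Lemma etaM_a1 n : etaM (a1 n) = Xempty n.
Proof.
apply/ffunP => x; rewrite etaME ffunE coxlenE a1E formC form_basis weight_I1 mul1r Ta1_I1.
by rewrite mul2n -addnn exprD invfM mulrVK // unitfE expf_neq0 // u_neq0.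
Qed.

Lemma etaM_Tact n (x : 'S_n) (m : Mod n) : etaM (Tact (@opM n) x m) = Tact (@opH n) x (etaM m).
Proof.
rewrite /Tact; move: (coxlen x) => k; elim: k x => //= k IH x.
by case: pickP => // i _; rewrite etaM_op IH.
Qed.

Lemma etaM_Haction n (h : Hecke n) (m : Mod n) : etaM (Haction (@opM n) h m) = hmul h (etaM m).
Proof.
rewrite /Haction linear_sum /=; apply: eq_bigr => x _.
by rewrite linearZ /= etaM_Tact.
Qed.

(** The coordinates of [etaM m] determine the pairings of [m] with all [T_x a_1]; these span M, and
    pairing with [a_w] recovers [m w] because the weight of [w] is nonzero. *)
Lemma etaM_inj n : injective (@etaM n).
Proof.
move=> m m' e; apply: Mod_ext => w; apply: (mulfI (weight_neq0 w)).
have form_Ta1 x : form (Ta1 x) m = form (Ta1 x) m'.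
  have := congr1 (fun h : Hecke n => h x) e; rewrite !etaME.
  by apply: mulfI; rewrite invr_eq0 expf_neq0 // u_neq0.
rewrite -!form_basis; have [h ->] := cyclic_basis w; rewrite !(formC (Haction _ _ _)).
have form_sum m0 : form m0 (Haction (@opM n) h (a1 n)) = \sum_x h x * form m0 (Ta1 x).
  rewrite /Haction /form; under [RHS]eq_bigr do rewrite big_distrr /=.
  rewrite exchange_big /=; apply: eq_bigr => v _.
  rewrite sum_ffunE big_distrr /=; apply: eq_bigr => x _.
  by rewrite scaleM /Ta1; ring.
by rewrite !form_sum; apply: eq_bigr => x _; rewrite !(formC _ (Ta1 x)) form_Ta1.
Qed.

Theorem theorem5p3 (n : nat) (hn : (1 <= n)%N) :
  exists eta : Mod n -> Hecke n,
    [/\ is_iso_onto_HX eta,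
        eta (a1 n) = Xempty n &
        forall eta' : Mod n -> Hecke n,
          is_iso_onto_HX eta' -> eta' (a1 n) = Xempty n ->
          forall m, eta' m = eta m].
Proof.
exists (@etaM n); split; last 1 first.
(* Every [m] is of the form h a_1, so an H-linear map is determined by its value at [a_1]. *)
- move=> eta' [_ eta'_H _ _] eta'_a1 m; have [h ->] := cyclic_all m.
  by rewrite eta'_H etaM_Haction eta'_a1 etaM_a1.
- split; [exact: etaM_is_linear|exact: etaM_Haction|exact: etaM_inj|].
  (* By cyclicity again, the image of M = H a_1 is H X_emptyset. *)
  move=> y; split=> [[h ->]|[m <-]].
    by exists (Haction (@opM n) h (a1 n)); rewrite etaM_Haction etaM_a1.
  by have [h ->] := cyclic_all m; exists h; rewrite etaM_Haction etaM_a1.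
- exact: etaM_a1.
Qed.
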